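(* Let $G$ be a finite abelian group and let $S\subseteq G$ with $0\in S$ be a generating, $2$-separable subset of $G$ such that $\kappa_2(S)\le|S|-1$. Assume that every element of $S\setminus\{0\}$ has order at least $|S|$. Then either $S$ is an arithmetic progression or $S\setminus\{0\}$ is periodic.
   Context: For $S\subseteq G$ with $0\in S$, $\langle S\rangle$ is the subgroup generated by $S$. $S$ is $2$-separable if there exists $X\subseteq\langle S\rangle$ with $|X|\ge 2$ and $|X+S|\le|\langle S\rangle|-2$; in that case $\kappa_2(S)=\min\{|X+S|-|X| : X\subseteq\langle S\rangle,\ |X|\ge 2,\ |X+S|\le|\langle S\rangle|-2\}$. An arithmetic progression is a set $\{a,a+r,\dots,a+(\ell-1)r\}$ of $\ell$ distinct elements. A set $X$ is periodic if there is a nonzero subgroup $H$ of $G$ with $X+H=X$. *)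

(* Defs.v *)
From mathcomp Require Import all_boot all_fingroup.

Set Implicit Arguments.
Unset Strict Implicit.
Unset Printing Implicit Defensive.

Local Open Scope group_scope.

(* Abelian groups are written multiplicatively: the sumset X + S is the
   pointwise product X * S, the neutral element 0 is 1, and the subgroup
   generated by S is <<S>>. *)

Section Defs.
Variable gT : finGroupType.
Implicit Types (G H : {group gT}) (S X : {set gT}).

(* |X + S| <= |<S>| - 2, without truncated subtraction. *)
Definition admissible2 S X : bool :=
  [&& X \subset <<S>>, 2 <= #|X| & #|X * S| + 2 <= #|<<S>>|].

Definition separable2 S : Prop := exists X : {set gT}, admissible2 S X.

(* When 1 \in S we have #|X| <= #|X * S|, so the subtraction is exact. The
   default #|<<S>>| exceeds the value at any admissible X, so it only matters
   when S is not 2-separable; see kappa2P. *)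
Definition kappa2 S : nat :=
  \big[minn/#|<<S>>|]_(X : {set gT} | admissible2 S X) (#|X * S| - #|X|).

Definition arithmetic_progression G X : Prop :=
  exists a r : gT, exists l : nat,
    [/\ a \in G, r \in G, injective (fun i : 'I_l => a * r ^+ i)
      & X = [set a * r ^+ i | i : 'I_l]].

Definition periodic G X : Prop :=
  exists H : {group gT}, [/\ H \subset G, H :!=: 1 & X * H = X].

Lemma kappa2P S : separable2 S ->
  (exists2 X, admissible2 S X & kappa2 S = #|X * S| - #|X|) /\
  (forall X, admissible2 S X -> kappa2 S <= #|X * S| - #|X|).
Proof.
move=> [X0 adm0].
have lb X : admissible2 S X -> kappa2 S <= #|X * S| - #|X|.
  move=> admX; rewrite /kappa2; have := mem_index_enum X.
  elim: (index_enum _) => // Y r IHr; rewrite inE big_cons.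
  case/predU1P=> [<- | /IHr le_r]; first by rewrite admX geq_minl.
  by case: ifP => // _; apply: leq_trans (geq_minr _ _) le_r.
split=> //.
have: kappa2 S = #|<<S>>| \/
      exists2 X, admissible2 S X & kappa2 S = #|X * S| - #|X|.
  rewrite /kappa2; apply: (big_ind (fun k => k = #|<<S>>| \/
      exists2 X, admissible2 S X & k = #|X * S| - #|X|)); first by left.
    by move=> x y Hx Hy; rewrite /minn; case: ifP.
  by move=> X admX; right; exists X.
case=> // eqk; have := lb _ adm0; rewrite eqk => le_k.
have /and3P[_ _ h] := adm0.
have := leq_trans h (leq_trans le_k (leq_subr _ _)).
by rewrite addn2 ltnNge leqW.
Qed.

End Defs.

(* Main.v *)
(* Hamidoune's isoperimetric method. A 2-atom A of S containing 1 is either a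
   subgroup or a set whose distinct translates meet in at most one point (called
   Sidon below). If A is a subgroup, |AS| < |A| + |S| and the order condition
   force S to meet A only in 1 and to be a union of A-cosets elsewhere. If
   |A| = 2, then S is a union of cosets of Q = <A> and at most one progression.
   If A is Sidon with |A| >= 3, then |AT| >= |A| + |T| for every T in Q = <A>
   with |T| >= 2 and |AT| <= |Q| - 2; hence either AS = QS, and the subgroup Q
   can replace A, or all but one of the Q-cosets met by S are full. When all but
   one of these cosets are full and S is not inside a single coset, the order
   condition forces the exceptional coset to be Q itself and to meet S only
   in 1. *)
Require Import Defs.
From mathcomp Require Import all_boot all_fingroup cyclic zify.

Set Implicit Arguments.
Unset Strict Implicit.
Unset Printing Implicit Defensive.

Local Open Scope group_scope.

Definition card_set (T : finType) (A : {set T}) := #|A|.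

(* Cardinals of the same set may mention different but convertible finType
   structures, which [lia] would treat as distinct atoms. *)
Ltac card_lia :=
  intros;
  repeat match goal with
  | H : is_true (leq _ _) |- _ => revert H
  | H : @eq nat _ _ |- _ => revert H
  end;
  cbv beta;
  repeat match goal with
  | |- context [@card ?T1 (@mem ?T2 ?P (@pred_of_set ?T3 ?A))] =>
    change (@card T1 (@mem T2 P (@pred_of_set T3 A))) with (card_set A)
  end;
  repeat match goal with
  | |- context [card_set ?A] => generalize (card_set A)
  end;
  clear; lia.

(** * Sidon sets and elementary bounds on product sets *)

Section IsoperimetricMethod.

Variable gT : finGroupType.
Implicit Types (G H Q : {group gT}) (A M N S T X Y : {set gT}).

(** [#|A :&: g *: A|] counts the representations [g = a * b^-1] with [a], [b] in [A]. *)
Definition sidon A := [forall g : gT, (g != 1) ==> (#|A :&: g *: A| <= 1)].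

Lemma sidonP A (g : gT) : sidon A -> g != 1 -> #|A :&: g *: A| <= 1.
Proof. by move/forallP/(_ g)/implyP. Qed.

Lemma sub_abelian_mulC G X Y :
  abelian G -> X \subset G -> Y \subset G -> X * Y = Y * X.
Proof.
move=> abG sXG sYG; apply: centC.
exact: subset_trans sXG (subset_trans abG (centS sYG)).
Qed.

Lemma leq_card_mulr X S : S != set0 -> #|X| <= #|X * S|.
Proof.
by case/set0Pn=> s sS; rewrite -(card_rcoset X s); apply/subset_leq_card/mulgS;
   rewrite sub1set.
Qed.

Lemma leq_card_mull X S : X != set0 -> #|S| <= #|X * S|.
Proof.
by case/set0Pn=> x xX; rewrite -(card_lcoset S x); apply/subset_leq_card/mulSg;
   rewrite sub1set.
Qed.

(** Submodularity: products distribute over unions, and [(X :&: Y) * S] lies in both [X * S] and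
    [Y * S]. *)
Lemma mulIU_card X Y S :
  #|(X :&: Y) * S| + #|(X :|: Y) * S| <= #|X * S| + #|Y * S|.
Proof.
rewrite mulUg addnC -[leqRHS]cardsUI leq_add2l; apply: subset_leq_card.
by rewrite subsetI !mulSg ?subsetIl ?subsetIr.
Qed.

(** * Duality and existence of 2-atoms *)

(** If [w * s^-1] were in [X], then [w] would be in [X * S]; so [W * S^-1] avoids [X]. Inversion
    turns [S^-1] back into [S]. *)
Lemma card_inv_compl G X S : abelian G -> X \subset G -> S \subset G ->
  let W := G :\: X * S in #|W^-1 * S| + #|X| <= #|G|.
Proof.
move=> abG sXG sSG /=; set W := G :\: _.
have sWG : W \subset G by apply: subsetDl.
have -> : W^-1 * S = (W * S^-1)^-1.
  by rewrite invMg invgK (@sub_abelian_mulC G) // -invGid invSg.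
rewrite card_invg.
have sub : W * S^-1 \subset G :\: X.
  apply/subsetP=> z /mulsgP[w s wW sS ->]; rewrite inE.
  move: wW sS; rewrite !inE => /andP[wXS wG] sS; apply/andP; split.
    by apply: contra wXS => wsX; rewrite -(mulgK s w) mem_mulg.
  by rewrite groupMl // -groupV (subsetP sSG).
have := subset_leq_card sub; have := subset_leq_card sXG.
by rewrite cardsDS //; card_lia.
Qed.

(* Take a 2-atom [A] through 1. If two translates of [A] share at least two
   points then, by submodularity of [X |-> #|X * S|], their intersection is
   again a 2-fragment, hence they coincide. Their union stays admissible because
   the inverse of the complement of [A * S] is a 2-fragment too, so that
   [#|A| <= #|G| - #|A * S|]. *)
Lemma atom_exists G S X0 :
  abelian G -> S \subset G -> S != set0 -> X0 \subset G ->
  2 <= #|X0| -> #|X0 * S| + 2 <= #|G| -> #|X0 * S| < #|X0| + #|S| ->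
  exists A, [/\ A \subset G, 1 \in A, 2 <= #|A|, #|A * S| + 2 <= #|G|
              & #|A * S| < #|A| + #|S|] /\ (group_set A \/ sidon A).
Proof.
move=> abG sSG S0 sX0G X0_2 X0S_2 X0_lt.
pose adm X := [&& X \subset G, 2 <= #|X| & #|X * S| + 2 <= #|G|].
have admX0 : adm X0 by apply/and3P.
have [X1 [admX1 minX1]] : exists X1 : {set gT}, adm X1 /\
    forall Y, adm Y -> #|X1 * S| - #|X1| <= #|Y * S| - #|Y|.
  by case: (arg_minnP (fun X => #|X * S| - #|X|) admX0) => X1; exists X1.
(* A 2-fragment does as well as the minimiser [X1]; the inequality is rearranged to avoid truncated
   subtraction. *)
pose frag X := adm X && (#|X * S| + #|X1| <= #|X1 * S| + #|X|).
have fragX1 : frag X1 by rewrite /frag admX1 leqnn.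
have leS X := leq_card_mulr X S0.
have minF X Y : frag X -> adm Y -> #|X * S| + #|Y| <= #|Y * S| + #|X|.
  move=> /andP[_ fX] /minX1; have := (leS X, leS Y, leS X1).
  by case=> [[? ?] ?]; card_lia.
have [A0 [fragA0 minA0]] : exists A0 : {set gT}, frag A0 /\
    forall X, frag X -> #|A0| <= #|X|.
  by case: (arg_minnP (fun X => #|X|) fragX1) => A0; exists A0.
have admA0 : adm A0 by case/andP: fragA0.
have /and3P[sA0G A0_2 A0S_2] := admA0.
have [a aA0] : exists a, a \in A0 by apply/set0Pn; rewrite -card_gt0; card_lia.
have aG := subsetP sA0G a aA0.
have card_tr g X : #|(g *: X) * S| = #|X * S| by rewrite -mulgA card_lcoset.
have sub_tr g X : g \in G -> X \subset G -> g *: X \subset G.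
  by move=> gG sXG; rewrite -(mulGid G) mulgSS ?sub1set.
pose A : {set gT} := a^-1 *: A0.
have sAG : A \subset G by rewrite sub_tr ?groupV.
have A_1 : 1 \in A by rewrite mem_lcoset invgK mulg1.
have cA : #|A| = #|A0| by rewrite card_lcoset.
have cAS : #|A * S| = #|A0 * S| by rewrite card_tr.
have admA : adm A by apply/and3P; rewrite cA cAS.
have fragA : frag A by rewrite /frag admA cA cAS; case/andP: fragA0.
have minA X : frag X -> #|A| <= #|X| by rewrite cA; apply: minA0.
clearbody A.
exists A; rewrite cA cAS; split.
  by split=> //; have := minF _ _ fragA0 admX0; card_lia.
have A_le : #|A| + #|A * S| <= #|G|.
  set W := G :\: A * S.
  have sASG : A * S \subset G by rewrite mul_subG.
  have cW : #|W| + #|A * S| = #|G|.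
    by rewrite cardsDS // subnK ?subset_leq_card.
  pose V : {set gT} := W^-1.
  have cV : #|V| = #|W| by rewrite card_invg.
  have leV : #|V * S| + #|A| <= #|G| by apply: card_inv_compl.
  suff /minA : frag V by card_lia.
  have sVG : V \subset G by rewrite -invGid invSg subsetDl.
  move/andP: (fragA) => [_ fA]; rewrite /frag /adm sVG /=.
  by apply/andP; split; [apply/andP; split |]; card_lia.
have overlap g : g \in G -> 2 <= #|A :&: g *: A| -> g *: A = A.
  move=> gG I_2; set B := g *: A in I_2 *.
  have cB : #|B| = #|A| by rewrite card_lcoset.
  have cBS : #|B * S| = #|A * S| by rewrite card_tr.
  have sBG : B \subset G by rewrite sub_tr.
  pose I : {set gT} := A :&: B; pose U : {set gT} := A :|: B.
  have subm : #|I * S| + #|U * S| <= #|A * S| + #|B * S| by apply: mulIU_card.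
  have cUI : #|U| + #|I| = #|A| + #|B| by apply: cardsUI.
  have I2 : 2 <= #|I| by [].
  have leIA : #|I| <= #|A| by apply/subset_leq_card/subsetIl.
  have leI : #|I * S| <= #|A * S| by apply/subset_leq_card/mulSg/subsetIl.
  have admI : adm I.
    by rewrite /adm I_2 subIset ?sAG //=; card_lia.
  have FI := minF _ _ fragA admI.
  have admU : adm U.
    rewrite /adm subUset sAG sBG /=; apply/andP.
    by split; card_lia.
  have FU := minF _ _ fragA admU.
  have /minA le : frag I.
    rewrite /frag admI /=; have := minF _ _ fragA admX1.
    by move/andP: fragA => [_]; card_lia.
  have eA : A :&: B = A by apply/eqP; rewrite eqEcard subsetIl.
  by apply/esym/eqP; rewrite eqEcard cB leqnn -eA subsetIr.
case: (boolP (sidon A)) => [|nsid]; [by right | left].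
move: nsid; rewrite negb_forall => /existsP[g].
rewrite negb_imply -ltnNge => /andP[g1 I_2].
have gG : g \in G.
  have /set0Pn[x] : A :&: g *: A != set0 by rewrite -card_gt0; exact: ltnW I_2.
  rewrite inE mem_lcoset => /andP[xA gxA].
  by rewrite -groupV -(groupMr _ (subsetP sAG _ xA)) (subsetP sAG).
have gA := overlap g gG I_2.
have gb b : b \in A -> g * b \in A by move=> bA; rewrite -gA mem_lcoset mulKg.
apply/group_setP; split=> // b c bA cA'.
have bG := subsetP sAG b bA.
(* The translate by [b] shares with [A] the two points [b] and [g * b = b * g], because [1] and [g]
   are in [A]. *)
suff <- : b *: A = A by rewrite mem_lcoset mulKg.
apply: overlap => //.
have gbn : b != g * b by rewrite eq_sym -{2}[b]mul1g (inj_eq (mulIg b)).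
apply: leq_trans (subset_leq_card (_ : [set b; g * b] \subset _)).
  by rewrite cards2 gbn.
apply/subsetP=> z; rewrite !inE mem_lcoset => /orP[] /eqP ->.
  by rewrite bA mulVg.
rewrite gb //= -((centsP abG) b bG g gG) mulKg.
by have := gb 1 A_1; rewrite mulg1.
Qed.

(** * Growth of products with a Sidon set *)

(** Add the elements of [T] one by one: a new translate of [A] meets each earlier one in at most one
    point. Two translates already cover [2 * #|A| - 1 >= #|A| + 2] points, and each later one adds a
    point since [#|T| <= #|A|]. *)
Lemma sidon_mul T A : sidon A -> 2 <= #|T| -> #|T| <= #|A| -> 3 <= #|A| ->
  #|A| + #|T| <= #|T * A|.
Proof.
move=> sid.
have add1 t X : t \notin X -> #|(t |: X) * A| + #|X| >= #|X * A| + #|A|.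
  move=> tX; rewrite mulUg.
  have := cardsUI (t *: A) (X * A); rewrite card_lcoset.
  suff : #|(t *: A) :&: (X * A)| <= #|X| by card_lia.
  have sub : (t *: A) :&: (X * A) \subset \bigcup_(x in X) (t *: A :&: x *: A).
    apply/subsetP=> z; rewrite inE => /andP[ztA /mulsgP[x y xX yA zE]].
    by apply/bigcupP; exists x; rewrite // inE ztA zE mem_lcoset mulKg.
  apply: leq_trans (subset_leq_card sub) _; rewrite -[leqRHS]sum1_card.
  elim/big_rec2: _ => [|x n U xX leU]; first by rewrite cards0.
  apply: leq_trans (leq_card_setU _ _) (leq_add _ leU).
  have -> : t *: A :&: x *: A = t *: (A :&: (t^-1 * x) *: A).
    apply/setP=> z; rewrite !inE !mem_lcoset inE mem_lcoset.
    by rewrite invMg invgK -mulgA mulKVg.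
  rewrite card_lcoset; apply: sidonP => //; apply: contraNneq tX => tx1.
  by rewrite -(mulKVg t x) tx1 mulg1 in xX.
move: {2}#|T| (leqnn #|T|) => n; elim: n T => [|n IH] T leT; first by card_lia.
move=> T2 TA A3.
have [t tT] : exists t, t \in T by apply/set0Pn; rewrite -card_gt0; card_lia.
have cT := cardsD1 t T; rewrite tT in cT.
have := add1 t (T :\ t); rewrite setD1K // !inE eqxx => /(_ isT) step.
have [T3 | T3] := leqP 2 #|T :\ t|.
  have /(_ _ T3 _ A3) le := IH (T :\ t).
  have {}le : #|A| + #|T :\ t| <= #|(T :\ t) * A| by apply: le; card_lia.
  by card_lia.
have /cards1P[u Tu] : #|T :\ t| == 1%N by card_lia.
by move: step cT; rewrite Tu card_lcoset cards1; card_lia.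
Qed.

(** For [h != 1] in [H], [M] and [h *: M] give [#|M * H| >= 2 * #|M| - 1]. Averaging with
    [#|M * H| >= 2 * #|H|] and rounding up gives the bound. *)
Lemma sidon_group M H : sidon M -> H :!=: 1 -> #|H| * 2 <= #|M * H| ->
  M * H = H * M -> #|M| + #|H| <= #|M * H|.
Proof.
move=> sid; case/trivgPn=> h0 hH h1 two com; pose h : gT := h0.
have sub : M :|: h *: M \subset M * H.
  by rewrite subUset mulG_subl com mulSg ?sub1set.
have := subset_leq_card sub; have := cardsUI M (h *: M).
by rewrite card_lcoset; have := sidonP sid (h1 : h != 1); card_lia.
Qed.

Lemma card_mul_group_ge2 M H : 1 \in M -> ~~ (M \subset H) ->
  #|H| * 2 <= #|M * H|.
Proof.
move=> M1 /subsetPn[m mM mH].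
have dis : [disjoint H & m *: H].
  apply/pred0P=> z /=; apply/negP=> /andP[zH].
  by rewrite mem_lcoset groupMr // groupV (negPf mH).
have -> : (#|H| * 2)%N = #|H :|: m *: H|.
  apply/esym/eqP; rewrite muln2 -addnn -{2}(card_lcoset H m).
  by rewrite (leq_card_setU _ _).
apply: subset_leq_card; rewrite subUset mulSg ?sub1set // andbT.
by rewrite -{1}[gval H]mul1g mulSg ?sub1set.
Qed.

(* A 2-atom of [M], whether a group or Sidon, grows too fast against [M]. *)
Lemma sidon_vosper G M T : abelian G -> <<M>> = G -> sidon M -> 1 \in M ->
  3 <= #|M| -> T \subset G -> 2 <= #|T| -> #|M * T| + 2 <= #|G| ->
  #|M| + #|T| <= #|M * T|.
Proof.
move=> abG genM sid M1 M3 sTG T2 MT2; rewrite leqNgt; apply/negP=> lt.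
have sMG : M \subset G by rewrite -genM subset_gen.
have comM X : X \subset G -> M * X = X * M.
  by move=> ?; apply: (@sub_abelian_mulC G).
have M0 : M != set0 by rewrite -card_gt0; card_lia.
rewrite comM // [#|M| + _]addnC in lt MT2.
have [N [[sNG N1 N2 NM2 NM] [gN | sidN]]] :=
  atom_exists abG sMG M0 sTG T2 MT2 lt.
  have [H eH] : {H : {group gT} | N = H} by exists (Group gN).
  have sHG : H \subset G by rewrite -eH.
  rewrite eH -?(comM H) // in N2 NM2 NM.
  have H1 : H :!=: 1 by apply/eqP=> H1; move: N2; rewrite H1 cards1.
  have two : #|H| * 2 <= #|M * H|.
    apply: card_mul_group_ge2 => //; apply/negP=> sMH.
    have GH : G :=: H by apply/eqP; rewrite eqEsubset -{1}genM gen_subG sMH.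
    by have := leq_card_mull H M0; rewrite -GH; rewrite -GH in NM2; card_lia.
  by have := sidon_group sid H1 two (comM H sHG); card_lia.
rewrite -comM // in NM.
(* Both sets are Sidon, so the larger one can play the Sidon factor in [sidon_mul]. *)
have [le|le] := leqP #|N| #|M|.
  by have := sidon_mul sid N2 le M3; rewrite -comM //; card_lia.
have le2 : 2 <= #|M| by card_lia.
have N3 : 3 <= #|N| by card_lia.
by have := sidon_mul sidN le2 (ltnW le) N3; card_lia.
Qed.

(** The loss of one against [sidon_vosper] pays for two extra cases: [T] a single point, and [M * T]
    missing just one point of [G]. In the latter, duality gives [#|M| + #|T| <= #|G|]. *)
Lemma sidon_mul_fibre G M T : abelian G -> <<M>> = G -> sidon M -> 1 \in M ->
  3 <= #|M| -> T \subset G -> T != set0 -> M * T != G ->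
  #|M| + #|T| <= #|M * T|.+1.
Proof.
move=> abG genM sid M1 M3 sTG T0 MT.
have sMG : M \subset G by rewrite -genM subset_gen.
have sMT : M * T \subset G by rewrite mul_subG.
have ltMT : #|M * T| < #|G| by apply: proper_card; rewrite properEneq MT.
have T1 : 0 < #|T| by rewrite card_gt0.
have [T2 | T2] := leqP 2 #|T|; last first.
  by have := leq_card_mulr M T0; card_lia.
have [MT2 | MT2] := leqP (#|M * T| + 2) #|G|.
  by have := sidon_vosper abG genM sid M1 M3 sTG T2 MT2; card_lia.
have M0 : M != set0 by rewrite -card_gt0; card_lia.
pose W := G :\: T * M; pose V : {set gT} := W^-1.
have leV : #|V * M| + #|T| <= #|G| by apply: card_inv_compl.
have V0 : V != set0.
  rewrite -card_gt0 card_invg cardsDS -(@sub_abelian_mulC G _ _ abG sMG sTG) //.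
  by rewrite subn_gt0.
have leM : #|M| <= #|V * M| by apply: leq_card_mull.
by card_lia.
Qed.

(** * Stable sets and the periodic conclusion *)

(** The right stabiliser of [S] is a group, and by finiteness [S :* a \subset S] already forces
    equality. *)
Lemma gen_stable S A : S * A \subset S -> S * <<A>> = S.
Proof.
move=> SA; pose H := [set g | S :* g == S].
have gH : group_set H.
  apply/group_setP; split; first by rewrite inE mulg1.
  by move=> g h; rewrite !inE rcosetM => /eqP-> /eqP->.
have sAH : A \subset H.
  apply/subsetP=> a aA; rewrite inE eqEcard card_rcoset leqnn andbT.
  by apply: subset_trans SA; rewrite mulgS // sub1set.
apply/eqP; rewrite eqEsubset mulG_subl andbT.
apply/subsetP=> _ /mulsgP[s a sS aA ->].
have : a \in Group gH by apply: subsetP aA; rewrite gen_subG.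
by rewrite inE => /eqP Sa; rewrite -Sa mem_rcoset mulgK.
Qed.

Lemma stable_setD S Q x : S * Q = S ->
  (S :\: x *: Q) * Q \subset S :\: x *: Q.
Proof.
move=> SQ; apply/subsetP=> z /mulsgP[s q]; rewrite !inE => /andP[sx sS] qQ ->.
have sqS : s * q \in S by rewrite -SQ mem_mulg.
rewrite sqS andbT; apply: contra sx.
by rewrite !mem_lcoset mulgA groupMr.
Qed.

(** If [1] were outside [x *: Q], all of [Q] would lie in [S], and the order condition would give
    [S = Q = G]. So [x *: Q = Q]. As [S] contains a full coset elsewhere, [#|Q| < #|S|], and the
    order condition leaves only [1] in [S :&: Q]. *)
Lemma periodic_of_coset G S Q x :
  1 \in S -> <<S>> = G -> S != G -> (forall y, y \in S :\ 1 -> #|S| <= #[y]) ->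
  Q \subset G -> Q :!=: 1 -> ~~ (S \subset x *: Q) ->
  (S :\: x *: Q) * Q \subset S :\: x *: Q -> periodic G (S :\ 1).
Proof.
move=> S1 genS SG ordS sQG Q1; set D := S :\: x *: Q => Sx DQ.
have sDS : D \subset S by apply: subsetDl.
have ordQ q : q \in Q -> q \in S -> q != 1 -> #|S| <= #|Q|.
  move=> qQ qS q1; apply: leq_trans (ordS q _) _; first by rewrite !inE q1.
  by rewrite subset_leq_card // cycle_subG.
have [y yD] : exists y, y \in D by apply/set0Pn; rewrite setD_eq0.
have yQD : y *: Q \subset D by apply: subset_trans DQ; rewrite mulSg ?sub1set.
have [D1 | D1] := boolP (1 \in D).
  have sQS : Q \subset S.
    apply: subset_trans sDS; apply: subset_trans DQ.
    by rewrite -{1}[gval Q]mul1g mulSg ?sub1set.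
  have [q qQ q1] := trivgPn Q Q1.
  have SQ : S = Q.
    by apply/esym/eqP; rewrite eqEcard sQS (ordQ q) // (subsetP sQS).
  by rewrite SQ -genS SQ genGid eqxx in SG.
have xQ : x *: Q = Q.
  move: D1; rewrite inE S1 andbT negbK mem_lcoset mulg1 groupV.
  exact: lcoset_id.
have leD : #|Q| <= #|D| by rewrite -(card_lcoset Q y) subset_leq_card.
have ltS : #|D| < #|S|.
  by apply: proper_card; apply/properP; split=> //; exists 1.
exists Q; split=> //.
suff -> : S :\ 1 = D.
  apply/eqP; rewrite eqEsubset DQ.
  exact: mulG_subl.
apply/setP=> z; rewrite !inE xQ; case zS: (z \in S); rewrite ?andbF // !andbT.
have [-> | z1] := eqVneq z 1; first by rewrite group1.
by apply/esym/negP=> zQ; have := ordQ z zQ zS z1; card_lia.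
Qed.

(** [S] is not inside [H], so [2 * #|H| <= #|H * S|], whence [#|H| < #|S|] and, by the order
    condition, [S :&: H = 1]. Then [S :|: H] is large enough to fill [H * S]. *)
Lemma periodic_of_subgroup G S H :
  abelian G -> 1 \in S -> <<S>> = G -> S != G ->
  (forall y, y \in S :\ 1 -> #|S| <= #[y]) ->
  H \subset G -> H :!=: 1 -> H * S != G -> #|H * S| < #|H| + #|S| ->
  periodic G (S :\ 1).
Proof.
move=> abG S1 genS SG ordS sHG H1 HS lt.
have sSG : S \subset G by rewrite -genS subset_gen.
have HSC : H * S = S * H by apply: (@sub_abelian_mulC G).
have SH : ~~ (S \subset H).
  apply: contra HS => sSH; have GH : G :=: H.
    by apply/eqP; rewrite eqEsubset sHG -genS gen_subG sSH.
  by rewrite eqEsubset mul_subG // GH mulg_subl.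
have two : #|H| * 2 <= #|S * H| by apply: card_mul_group_ge2.
have sSHS : S \subset H * S by rewrite mulG_subr.
have sHHS : H \subset H * S by rewrite HSC -{1}[gval H]mul1g mulSg ?sub1set.
rewrite -HSC in two.
have SI : S :&: H = 1.
  apply/eqP; rewrite eqEsubset andbC sub1set inE S1 group1 /=.
  apply/subsetP=> q; rewrite inE => /andP[qS qH]; apply/set1P/eqP.
  apply: contraTT isT => q1.
  have : #|S| <= #|H|.
    apply: leq_trans (ordS q _) _; first by rewrite !inE q1.
    by rewrite subset_leq_card // cycle_subG.
  by card_lia.
have full : H * S = S :|: H.
  apply/eqP; rewrite eq_sym eqEcard subUset sSHS sHHS /=.
  by have := cardsUI S H; rewrite SI cards1; card_lia.
apply: (@periodic_of_coset G S H 1) => //; rewrite mul1g //.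
apply/subsetP=> z /mulsgP[s q]; rewrite !inE => /andP[sH sS] qH ->.
have : s * q \in H * S by rewrite HSC mem_mulg.
by rewrite full inE groupMr // (negPf sH) orbF.
Qed.

(** * Atoms with two elements *)

(** Multiplication by [r] leaves [S] only at [e]. [P] is the run of [S] ending at [e]; the rest of
    [S] is closed under [r]. *)
Lemma progression_split S e r : e \in S -> e * r \notin S ->
  (forall x, x \in S -> x != e -> x * r \in S) ->
  exists a l, let P := [set a * r ^+ i | i : 'I_l] in
  [/\ injective (fun i : 'I_l => a * r ^+ i), e \in P, P \subset S,
      P \subset e *: <[r]> & (S :\: P) * <[r]> = S :\: P].
Proof.
move=> eS erS step.
have o2 : 1 < #[r].
  rewrite ltnNge; apply: contra erS => o1.
  suff -> : r = 1 by rewrite mulg1.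
  by apply/eqP; rewrite -order_eq1 eqn_leq o1 order_gt0.
(* Walking back [#[r].-1] steps from [e] reaches [e * r], outside [S]; so the run has length [l <
   #[r]] and its terms are distinct. *)
have rV : r ^- #[r].-1 = r.
  apply: (mulIg (r ^+ #[r].-1)).
  by rewrite mulVg -expgS prednK ?order_gt0 // expg_order.
have ex : exists l, (0 < l) && (e * r ^- l \notin S).
  by exists #[r].-1; rewrite rV erS andbT; card_lia.
have [l /andP[l0 lS] minl] := ex_minnP ex.
have lo : l < #[r].
  rewrite -(ltn_predK o2) ltnS; apply: minl.
  by rewrite rV erS andbT; card_lia.
have inS j : j < l -> e * r ^- j \in S.
  case: j => [|j] jl; first by rewrite invg1 mulg1.
  by apply: contraLR jl => jS; rewrite -leqNgt minl.
exists (e * r ^- l.-1), l; set P := imset _ _.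
have aE i : i < l -> e * r ^- l.-1 * r ^+ i = e * r ^- (l.-1 - i).
  move=> il; have [k ->] : exists k, l.-1 = (i + k)%N.
    by exists (l.-1 - i); card_lia.
  by rewrite addKn expgD invMg mulgA mulgKV.
have memP z : reflect (exists2 j, j < l & z = e * r ^- j) (z \in P).
  apply: (iffP imsetP) => [[i _ ->]|[j jl ->]].
    by exists (l.-1 - i); [card_lia | rewrite aE].
  have jl' : l.-1 - j < l by card_lia.
  by exists (Ordinal jl'); rewrite //= aE // subKn //; card_lia.
have eP : e \in P by apply/memP; exists 0; rewrite // invg1 mulg1.
split=> //.
- by move=> i j /mulgI/eqP; rewrite eq_expg_ord ?(ltnW lo) // => /eqP.
- by apply/subsetP=> z /memP[j jl ->]; apply: inS.
- apply/subsetP=> z /memP[j jl ->].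
  by rewrite mem_lcoset mulKg groupV mem_cycle.
apply: gen_stable; apply/subsetP=> _ /mulsgP[x _ xSP /set1P-> ->].
move: xSP; rewrite !inE => /andP[xP xS].
have xe : x != e by apply: contraNneq xP => ->.
rewrite step // andbT; apply: contra xP => /memP[j jl xr].
have {xr}xE : x = e * r ^- j.+1.
  by rewrite expgS invMg mulgA -xr mulgK.
have [jl'|lj] := ltnP j.+1 l.
  by apply/memP; apply: (ex_intro2 _ _ j.+1 jl' xE).
have jE : j.+1 = l by apply/eqP; rewrite eqn_leq jl lj.
by case/negP: lS; rewrite -jE -xE.
Qed.

(** At most one point of [S * r] lies outside [S]. With none, [S] is stable under [<[r]>]; with one,
    [progression_split] applies. *)
Lemma progression_or_periodic_of_pair G S r :
  1 \in S -> <<S>> = G -> S != G -> (forall y, y \in S :\ 1 -> #|S| <= #[y]) ->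
  r \in G -> r != 1 -> #|[set 1; r] * S| <= #|S|.+1 -> abelian G ->
  arithmetic_progression G S \/ periodic G (S :\ 1).
Proof.
move=> S1 genS SG ordS rG r1 le abG.
have sSG : S \subset G by rewrite -genS subset_gen.
have sQG : <[r]> \subset G by rewrite cycle_subG.
have Q1 : <[r]> != 1 by rewrite cycle_eq1.
have [stab | /subsetPn[_ /mulsgP[e _ eS /set1P-> ->] erS]] :=
  boolP (S * [set r] \subset S).
  have SQ := gen_stable stab; right.
  apply: (@periodic_of_coset G S <[r]>%G 1) => //.
    rewrite mul1g; apply: contra SG => sSQ; rewrite eqEsubset sSG /=.
    have sQS : <[r]> \subset S by rewrite -SQ -{1}[<[r]>]mul1g mulSg ?sub1set.
    by apply: subset_trans sQS; rewrite -genS gen_subG.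
  exact: stable_setD.
have step x : x \in S -> x != e -> x * r \in S.
  move=> xS xe; apply: contraTT isT => xrS.
  have sub : S :|: [set e * r; x * r] \subset [set 1; r] * S.
    apply/subsetP=> z; rewrite !inE => /orP[zS|/orP[]/eqP->].
    - by rewrite -[z]mul1g mem_mulg // !inE eqxx.
    - rewrite -((centsP abG) r rG e (subsetP sSG _ eS)) mem_mulg //.
      by rewrite !inE eqxx orbT.
    - rewrite -((centsP abG) r rG x (subsetP sSG _ xS)) mem_mulg //.
      by rewrite !inE eqxx orbT.
  have dis : [disjoint S & [set e * r; x * r]].
    rewrite disjoint_sym; apply/pred0P=> z /=; rewrite !inE.
    by apply/negP=> /andP[/orP[]/eqP->]; apply/negP.
  have := subset_leq_card sub; move: (leq_card_setU S [set e * r; x * r]).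
  move/leqifP; rewrite dis => /eqP ->.
  rewrite cards2 (inj_eq (mulIg r)) eq_sym xe.
  by card_lia.
have [a [l [injP eP sPS sPe stab]]] := progression_split eS erS step.
set P := [set _ | _ in _] in eP sPS sPe stab.
have [SP | SP] := boolP (S \subset P).
  have SE : S = P by apply/eqP; rewrite eqEsubset SP sPS.
  have l0 : 0 < l.
    by move: eP => /imsetP[i _ _]; apply: leq_ltn_trans (ltn_ord i).
  left; exists a, r, l; split=> //.
  rewrite (subsetP sSG) // SE.
  by apply/imsetP; exists (Ordinal l0); rewrite //= mulg1.
right; apply: (@periodic_of_coset G S <[r]>%G e) => //.
  (* Were [S] inside [e *: <[r]>], the stable nonempty set [S :\: P] would contain that whole coset,
     hence [e], which is in [P]. *)
  have /set0Pn[y yD] : S :\: P != set0 by rewrite setD_eq0.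
  apply/negP=> /subsetP/(_ y) ye.
  have {}ye : y \in e *: <[r]> by apply: ye; move: yD; rewrite inE => /andP[].
  suff : e \in S :\: P by rewrite inE eP.
  rewrite -stab -(mulKVg y e) mem_mulg //.
  by move: ye; rewrite mem_lcoset -groupV invMg invgK.
suff -> : S :\: e *: <[r]> = (S :\: P) :\: e *: <[r]>.
  by apply: (@stable_setD _ <[r]>%G).
apply/setP=> z; rewrite !inE; case ze: (z \in e *: <[r]>) => //=.
by case zP: (z \in P) => //; rewrite (subsetP sPe) in ze.
Qed.

(** * Sidon atoms with at least three elements *)

Lemma periodic_of_sidon G S M :
  abelian G -> 1 \in S -> <<S>> = G -> S != G ->
  (forall y, y \in S :\ 1 -> #|S| <= #[y]) ->
  M \subset G -> sidon M -> 1 \in M -> 3 <= #|M| ->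
  #|M * S| + 2 <= #|G| -> #|M * S| < #|M| + #|S| ->
  periodic G (S :\ 1).
Proof.
move=> abG S1 genS SG ordS sMG sid M1 M3 MS2 lt.
have sSG : S \subset G by rewrite -genS subset_gen.
pose Q := <<M>>%G.
have sQG : Q \subset G by rewrite gen_subG.
have sMQ : M \subset Q by apply: subset_gen.
have abQ : abelian Q := abelianS sQG abG.
have Q1 : Q :!=: 1.
  by apply/eqP=> Q1; have := subset_leq_card sMQ; rewrite Q1 cards1; card_lia.
have SQ : ~~ (S \subset Q).
  apply/negP=> sSQ.
  have GQ : G :=: Q by apply/eqP; rewrite eqEsubset sQG -genS gen_subG sSQ.
  have S0 : 0 < #|S| by rewrite card_gt0; apply/set0Pn; exists 1.
  have S2 : 2 <= #|S|.
    rewrite ltnNge; apply/negP=> le1.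
    have /cards1P[x Sx] : #|S| == 1%N by rewrite eqn_leq le1.
    case/trivgPn: Q1 => q qQ /eqP; case; apply/set1P.
    move: S1; rewrite Sx => /set1P x1.
    move: qQ; rewrite -GQ -genS Sx -x1.
    by rewrite -[[set 1]]/(gval (one_group gT)) genGid.
  have := @sidon_vosper G M S abG (esym GQ) sid M1 M3 sSG S2 MS2; card_lia.
have [full | /subsetPn[z zQS zMS]] := boolP (Q * S \subset M * S).
  have QS : Q * S = M * S.
    by apply/eqP; rewrite eqEsubset full mulSg.
  apply: (@periodic_of_subgroup G S Q) => //.
    by rewrite QS; apply: contraTneq MS2 => ->; rewrite -ltnNge addn2 leqW.
  rewrite QS; apply: leq_trans lt _; rewrite leq_add2r; exact: subset_leq_card.
case/mulsgP: zQS => q y qQ yS zE.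
have yG := subsetP sSG y yS.
(* The coset of the missed point [z] is the exceptional one; [T] is its part of [S] moved into [Q],
   where [q \notin M * T]. *)
pose U := S :&: y *: Q; pose V := S :\: y *: Q; pose T := y^-1 *: U.
have cT : #|T| = #|U| by rewrite card_lcoset.
have comM X : X \subset G -> M * X = X * M.
  by move=> ?; apply: (@sub_abelian_mulC G).
have sT : T \subset Q.
  apply/subsetP=> t; rewrite mem_lcoset invgK inE => /andP[_].
  by rewrite mem_lcoset mulKg.
have T0 : T != set0.
  by apply/set0Pn; exists 1; rewrite mem_lcoset invgK mulg1 inE yS lcoset_refl.
have sS1G : U \subset G by rewrite subIset // sSG.
have sS2G : V \subset G by rewrite subDset subsetU // sSG orbT.
have cMT : #|M * T| = #|M * U|.
  by rewrite !comM ?(subset_trans sT) // -mulgA card_lcoset.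
have MT : M * T != Q.
  apply: contra zMS => /eqP MT.
  have : q \in M * T by rewrite MT.
  case/mulsgP=> m t mM tT qE.
  have tG : t \in G by apply: (subsetP sQG); apply: (subsetP sT).
  apply/mulsgP; exists m (t * y) => //.
    move: tT; rewrite mem_lcoset invgK inE => /andP[].
    by rewrite ((centsP abG) y yG t tG).
  by rewrite zE qE mulgA.
have big := sidon_mul_fibre abQ erefl sid M1 M3 sT T0 MT.
have dis : [disjoint M * U & M * V].
  apply/pred0P=> w /=; apply/negP=> /andP[].
  case/mulsgP=> m s mM; rewrite !inE => /andP[sS sy] wE.
  case/mulsgP=> m' s' m'M; rewrite !inE => /andP[/negP sy' s'S] wE'; apply: sy'.
  have -> : s' = s * (m * m'^-1).
    have sG := subsetP sSG s sS; have mG := subsetP sMG m mM.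
    have s'G := subsetP sSG s' s'S; have m'G := subsetP sMG m' m'M.
    rewrite mulgA -((centsP abG) m mG s sG) -wE wE'.
    by rewrite ((centsP abG) m' m'G s' s'G) mulgK.
  move: sy; rewrite !mem_lcoset mulgA => sy.
  by rewrite groupM // groupM ?groupV // (subsetP sMQ).
have eMS : M * S = M * U :|: M * V by rewrite -mulgU setID.
have cMS : #|M * S| = #|M * U| + #|M * V|.
  rewrite eMS; have := leq_card_setU (M * U) (M * V).
  by move/leqifP; rewrite dis => /eqP.
have cS : #|U| + #|V| = #|S| by rewrite cardsID.
have sub2 : V \subset M * V by rewrite -{1}[V]mul1g mulSg ?sub1set.
(* By [big], [M * U] takes at least [#|M| + #|U| - 1] of the at most [#|M| + #|S| - 1] points of
   [M * S], leaving at most [#|V|] for [M * V]. *)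
have eS2 : M * V = V by apply/esym/eqP; rewrite eqEcard sub2; card_lia.
apply: (@periodic_of_coset G S Q y) => //.
  apply: contra SQ => /subsetP sSy; have := sSy 1 S1.
  rewrite mem_lcoset mulg1 groupV => yQ.
  by apply/subsetP=> s /sSy; rewrite lcoset_id.
by rewrite gen_stable // -comM // eS2.
Qed.

End IsoperimetricMethod.

Theorem theorem3p1 (gT : finGroupType) (G : {group gT}) (S : {set gT})
    (abelG : abelian G) (S1 : 1 \in S) (genS : <<S>> = G)
    (sepS : separable2 S) (kappaS : kappa2 S <= #|S| - 1)
    (ordS : forall x : gT, x \in S :\ 1 -> #|S| <= #[x]) :
  arithmetic_progression G S \/ periodic G (S :\ 1).
Proof.
have [X [sXG X2 XS2 leS1]] : exists X : {set gT},
    [/\ X \subset G, 2 <= #|X|, #|X * S| + 2 <= #|G| &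
        #|X * S| - #|X| <= #|S| - 1].
  have [[X /and3P[sXG X2 XS2] kX] _] := kappa2P sepS.
  by rewrite genS in sXG XS2; exists X; split=> //; rewrite -kX.
have sSG : S \subset G by rewrite -genS subset_gen.
have S0 : S != set0 by apply/set0Pn; exists 1.
have Spos : 0 < #|S| by rewrite card_gt0.
have leX : #|X| <= #|X * S| by apply: leq_card_mulr.
(* Both truncated subtractions in [leS1] are exact, by [leX] and [Spos]. *)
have ltX : #|X * S| < #|X| + #|S| by card_lia.
have [A [[sAG A1 A2 AS2 ltA] alt]] := atom_exists abelG sSG S0 sXG X2 XS2 ltX.
have A0 : A != set0 by apply/set0Pn; exists 1.
have SG : S != G.
  apply: contraTneq AS2 => SG.
  by have := leq_card_mull S A0; rewrite -SG; card_lia.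
case: alt => [gA | sidA].
  right; apply: (@periodic_of_subgroup _ G S (Group gA)) => //.
    by apply/eqP=> A1'; move: A2; rewrite -[A]/(gval (Group gA)) A1' cards1.
  by apply: contraTneq AS2 => /= ->; rewrite -ltnNge addn2 leqW.
have [A3 | A3] := leqP 3 #|A|.
  by right; apply: (@periodic_of_sidon _ G S A).
have : #|A| == 2 by rewrite eqn_leq A2 andbT -ltnS.
rewrite (cardsD1 1) A1 add1n eqSS => /cards1P[r Ar].
have AE : A = [set 1; r] by rewrite -(setD1K A1) Ar.
have : r \in A :\ 1 by rewrite Ar set11.
rewrite !inE => /andP[r1 rA].
apply: (@progression_or_periodic_of_pair _ G S r) => //.
  exact: subsetP rA.
by rewrite -AE; card_lia.
Qed.
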